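(* For every $n\geq 1$, $$\sum_{e\in \mathbf{I}_n(>,-,>)} t^{\mathrm{asc}(e)}q^{\mathrm{Dt}(e)}=\sum_{e\in \mathbf{I}_n(>,\neq,\geq)} t^{\,n-1-\mathrm{asc}(e)}q^{\mathrm{Dt}(e)}.$$
   Context: An inversion sequence of length $n$ is a word $e=e_1\cdots e_n$ of nonnegative integers with $0\leq e_i\leq i-1$ for all $i\in[n]$; $\mathbf{I}_n$ denotes the set of them. For relations $\rho_1,\rho_2,\rho_3\in\{<,>,\leq,\geq,=,\neq,-\}$ (where $-$ is the trivial relation always holding), $\mathbf{I}_n(\rho_1,\rho_2,\rho_3)$ is the set of $e\in\mathbf{I}_n$ with no indices $1\leq i<j<k\leq n$ such that $e_i\,\rho_1\,e_j$, $e_j\,\rho_2\,e_k$, $e_i\,\rho_3\,e_k$. For a word $w$ of length $n$: $\mathrm{asc}(w)=|\{i\in[n-1]:w_i<w_{i+1}\}|$, and $\mathrm{Dt}(w)$ is the multiset $\{w_i: 1\leq i<n,\ w_i>w_{i+1}\}$ of descent tops. For a multiset $S$ of nonnegative integers, $q^{S}=\prod_{s\in S}q_s$ (with multiplicity) in commuting variables $q_0,q_1,\dots$. *)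

(* Defs.v *)
From mathcomp Require Import all_boot all_order all_algebra.
From mathcomp Require Import finmap multiset monalg.

Set Implicit Arguments.
Unset Strict Implicit.
Unset Printing Implicit Defensive.

Import GRing.Theory.
Local Open Scope mset_scope.
Local Open Scope nat_scope.

(* Words are 0-indexed: the letter w_i of the literature is nth 0 w i.-1. *)

Definition inversion_seq (w : seq nat) : bool :=
  [forall i : 'I_(size w), nth 0 w i <= i].

Definition avoids (r1 r2 r3 : rel nat) (w : seq nat) : bool :=
  ~~ [exists i : 'I_(size w), exists j : 'I_(size w), exists k : 'I_(size w),
        [&& i < j, j < k,
            r1 (nth 0 w i) (nth 0 w j),
            r2 (nth 0 w j) (nth 0 w k) &
            r3 (nth 0 w i) (nth 0 w k)]].

Definition neq_rel : rel nat := [rel a b | a != b].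
Definition any_rel : rel nat := [rel _ _ | true].

Definition word (n : nat) (e : n.-tuple 'I_n) : seq nat :=
  [seq val x | x <- e].

(* All letters of an inversion sequence of length n are < n, so taking the
   letters in 'I_n loses nothing and makes the ambient type finite. *)
Definition inv_seqs (n : nat) (r1 r2 r3 : rel nat) : {set n.-tuple 'I_n} :=
  [set e : n.-tuple 'I_n |
     inversion_seq (word e) && avoids r1 r2 r3 (word e)].

Definition asc (w : seq nat) : nat :=
  #|[set i : 'I_(size w).-1 | nth 0 w i < nth 0 w i.+1]|.

Definition Dt (w : seq nat) : {mset nat} :=
  seq_mset [seq nth 0 w i |
              i <- iota 0 (size w).-1 & nth 0 w i > nth 0 w i.+1].

Local Open Scope ring_scope.

(* Z[q_0, q_1, ...] : integer polynomials in countably many commuting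
   variables, as the monoid algebra of the free commutative monoid on nat. *)
Notation qring := {malg int[{cmonom nat}]}.

Definition qvar (i : nat) : qring := << ucm i >>.

Definition qpow (S : {mset nat}) : qring := \prod_(s <- S) qvar s.

(* Main.v *)
(** Both classes are read from left to right. In a word avoiding (>,-,>) let [b]
    be the largest letter so far and [a] the largest letter already followed by
    a smaller one: the next letter is at least [b], or one of the [b - a]
    letters of [[a, b[], which creates the descent top [b] and replaces [a] by
    [b]. In a word avoiding (>,!=,>=) let [x] be the bottom of the last descent
    and [m] its top: the letters below the maximum [b] that may follow are [x]
    and those strictly between [m] and [b], again [b - m] in number. Hence the
    two classes obey the same recursion, with a weight [s] for climbing to a new
    maximum and a weight [u] for staying at it, where [(s, u) = (t, 1)] for the
    first class and [(1, t)] for the second.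

    For a fixed value [v], the generating polynomial [F_v(z)] of the possible
    continuations, with [z] recording how far the current position exceeds [v],
    satisfies (up to a remainder that is linear in [z])
      [(z - u)^2 F_v = z (z - u) (z - u + s) F_(v+1) + t w (z - u + t) F'_(v+1)],
    where [F'] is the same polynomial after a descent from [v] and [w] is the
    weight of that descent. The substitution [z := z + t - 1] maps the equation
    for [(1, t)] to the one for [(t, 1)]; as [(z - 1)^2] is monic of degree 2 the
    remainder plays no role, so [F_v] for [(1, t)] becomes [F_v] for [(t, 1)]. *)

Require Import Defs.
From mathcomp Require Import all_boot all_order all_algebra.
From mathcomp Require Import finmap multiset monalg.
From mathcomp Require Import zify ring.

Set Implicit Arguments.
Unset Strict Implicit.
Unset Printing Implicit Defensive.

Import GRing.Theory.
Local Open Scope ring_scope.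

(** * Statistics of a word after one more letter *)

Definition descent_tops (w : seq nat) : seq nat :=
  [seq nth 0%N w i | i <- iota 0 (size w).-1 & (nth 0 w i.+1 < nth 0 w i)%N].

Lemma ascE (w : seq nat) :
  asc w = (\sum_(i < (size w).-1) (nth 0 w i < nth 0 w i.+1))%N.
Proof. by rewrite /asc cardsE -sum1_card [LHS]big_mkcond. Qed.

(** For empty [p] the bound forces [c = 0], so the default last letter [0] creates no spurious
    ascent. *)
Lemma asc_rcons (p : seq nat) (c : nat) :
  (c <= size p)%N -> asc (rcons p c) = (asc p + (last 0 p < c))%N.
Proof.
case/lastP: p => [|p x]; first by rewrite /= leqn0 !ascE !big_ord0 => /eqP->.
move=> _; rewrite !ascE !size_rcons /= big_ord_recr /= last_rcons.
congr (_ + _)%N; last by rewrite !nth_rcons size_rcons ltnS leqnn !ltnn !eqxx.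
apply: eq_bigr => i _; have lt_ip := ltn_ord i.
by rewrite ![nth _ (rcons _ c) _]nth_rcons !size_rcons ltnS (ltnW lt_ip) ltnS lt_ip.
Qed.

Lemma asc_leq_size (w : seq nat) : (asc w <= (size w).-1)%N.
Proof. by rewrite /asc -[leqRHS]card_ord max_card. Qed.

Lemma descent_tops_rcons (p : seq nat) (c : nat) :
  descent_tops (rcons p c)
  = descent_tops p ++ nseq (c < last 0 p)%N (last 0%N p).
Proof.
case/lastP: p => [|p x] //; rewrite /descent_tops !size_rcons -!pred_Sn last_rcons.
rewrite -[(size p).+1]addn1 iotaD filter_cat map_cat add0n; congr (_ ++ _).
  rewrite (@eq_in_filter _ _ (fun i => (nth 0 (rcons p x) i.+1 < nth 0 (rcons p x) i)%N)).
    apply/eq_in_map => i; rewrite mem_filter mem_iota => /andP[_ /andP[_ lt_ip]].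
    by rewrite nth_rcons size_rcons ltnS ltnW.
  move=> i; rewrite mem_iota add0n => /andP[_ lt_ip].
  by rewrite !(nth_rcons _ (rcons _ _)) !size_rcons !ltnS lt_ip (ltnW lt_ip).
rewrite /= !nth_rcons !size_rcons ltnS leqnn !ltnn !eqxx.
by case: ltnP => //= _; rewrite !nth_rcons size_rcons ltnSn ltnn eqxx.
Qed.

Lemma inversion_seq_rcons (p : seq nat) (c : nat) :
  inversion_seq (rcons p c) = inversion_seq p && (c <= size p)%N.
Proof.
apply/forallP/andP => [inv_pc|[/forallP inv_p le_cp] [i]].
  split.
    apply/forallP => -[i lt_ip] /=.
    have lt_ipc : (i < size (rcons p c))%N by rewrite size_rcons ltnW.
    by move: (inv_pc (Ordinal lt_ipc)); rewrite /= nth_rcons lt_ip.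
  have lt_ipc : (size p < size (rcons p c))%N by rewrite size_rcons.
  by move: (inv_pc (Ordinal lt_ipc)); rewrite /= nth_rcons ltnn eqxx.
rewrite /= nth_rcons size_rcons ltnS leq_eqVlt => /predU1P[->|lt_ip].
  by rewrite ltnn eqxx.
by rewrite lt_ip; apply: (inv_p (Ordinal lt_ip)).
Qed.

Lemma inversion_seq_bound (p : seq nat) (x : nat) :
  inversion_seq p -> x \in p -> (x < size p)%N.
Proof.
move=> /forallP inv_p x_p; have lt_xp : (index x p < size p)%N by rewrite index_mem.
by move: (inv_p (Ordinal lt_xp)); rewrite /= nth_index // => /leq_ltn_trans; apply.
Qed.

(** * Pattern avoidance, letter by letter *)

Section Avoidance.
Variables r1 r2 r3 : rel nat.

(* The pattern does not occur in [rcons p c] with [c] as its third letter. *)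
Definition extends (p : seq nat) (c : nat) : Prop :=
  forall i j, (i < j < size p)%N ->
    ~~ [&& r1 (nth 0%N p i) (nth 0%N p j), r2 (nth 0%N p j) c &
           r3 (nth 0%N p i) c].

(** Each occurrence of the pattern is charged to its third letter. *)
Lemma avoidsP (w : seq nat) :
  reflect (forall k, (k < size w)%N -> extends (take k w) (nth 0%N w k))
          (avoids r1 r2 r3 w).
Proof.
apply: (iffP idP) => [av k lt_kw i j|ext].
  rewrite size_takel ?(ltnW lt_kw) // => /andP[lt_ij lt_jk].
  apply: contra av => bad; have lt_jw := ltn_trans lt_jk lt_kw.
  apply/existsP; exists (Ordinal (ltn_trans lt_ij lt_jw)).
  apply/existsP; exists (Ordinal lt_jw); apply/existsP; exists (Ordinal lt_kw).
  by rewrite /= lt_ij lt_jk; rewrite !nth_take // in bad; apply: ltn_trans lt_jk.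
apply/existsP => -[[i lt_i]] /existsP[[j lt_j]] /existsP[[k lt_k]] /=.
move=> /andP[lt_ij /andP[lt_jk bad]]; have := ext k lt_k i j.
rewrite lt_ij size_takel ?(ltnW lt_k) // lt_jk => /(_ isT).
by rewrite !nth_take ?(ltn_trans lt_ij) // bad.
Qed.

Lemma avoids_rcons (p : seq nat) (c : nat) :
  avoids r1 r2 r3 (rcons p c) <-> avoids r1 r2 r3 p /\ extends p c.
Proof.
split=> [/avoidsP av|[/avoidsP av ext]].
  split; last first.
    have := av (size p); rewrite size_rcons ltnSn -cats1 take_size_cat //.
    by rewrite nth_cat ltnn subnn; apply.
  apply/avoidsP => k lt_kp; have := av k; rewrite size_rcons ltnW //.
  by rewrite -cats1 takel_cat ?(ltnW lt_kp) // nth_cat lt_kp; apply.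
apply/avoidsP => k; rewrite size_rcons ltnS leq_eqVlt => /predU1P[->|lt_kp].
  by rewrite -cats1 take_size_cat // nth_cat ltnn subnn.
by rewrite -cats1 takel_cat ?(ltnW lt_kp) // nth_cat lt_kp; apply: av.
Qed.

Lemma extends_rcons (p : seq nat) (c d : nat) :
  extends (rcons p c) d <->
  extends p d /\ forall y, y \in p -> ~~ [&& r1 y c, r2 c d & r3 y d].
Proof.
split=> [ext|[ext bad] i j].
  split=> [i j /andP[lt_ij lt_jp]|y y_p].
    have := ext i j; rewrite size_rcons lt_ij ltnW //= !nth_rcons lt_jp.
    by rewrite (ltn_trans lt_ij lt_jp); apply.
  have := ext (index y p) (size p); rewrite size_rcons ltnSn index_mem y_p.
  by rewrite !nth_rcons ltnn eqxx index_mem y_p nth_index //; apply.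
rewrite size_rcons ltnS => /andP[lt_ij]; rewrite leq_eqVlt => /predU1P[Ej|lt_jp].
  rewrite Ej in lt_ij *.
  by rewrite !nth_rcons lt_ij ltnn eqxx; apply: bad; rewrite mem_nth.
by rewrite !nth_rcons lt_jp (ltn_trans lt_ij) //; apply: ext; rewrite lt_ij.
Qed.

Lemma extends_nil (c : nat) : extends [::] c.
Proof. by move=> i j; rewrite andbF. Qed.

Definition admissible (w : seq nat) : bool :=
  inversion_seq w && avoids r1 r2 r3 w.

Lemma admissible_rcons (p : seq nat) (c : nat) :
  admissible (rcons p c)
  <-> [/\ admissible p, (c <= size p)%N & extends p c].
Proof.
rewrite /admissible inversion_seq_rcons; split.
  by case/andP => /andP[-> ->] /avoids_rcons[-> ].
by case=> /andP[-> av] -> ext; apply/avoids_rcons.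
Qed.

Lemma admissible_catl (p w : seq nat) : admissible (p ++ w) -> admissible p.
Proof.
elim/last_ind: w => [|w c IHw]; first by rewrite cats0.
by rewrite -rcons_cat => /admissible_rcons[/IHw].
Qed.

Lemma admissible_nil : admissible [::].
Proof. by apply/andP; split; [apply/forallP => -[] | apply/avoidsP]. Qed.

End Avoidance.

(** * The common recursion and its kernel equation *)

Lemma polyX_inj (R : comNzRingType) : injective (fun p : {poly R} => 'X * p).
Proof.
by move=> p r /polyP eq_pr; apply/polyP => i; have := eq_pr i.+1; rewrite !coefXM.
Qed.

Section Kernel.
Variables (R : comNzRingType) (t : R) (q : nat -> R).

Section Recursion.
Variables s u : R.

(* [k] letters remain to be placed after the first [i]; [b] is the maximum so far,
   [a] the last descent top ([0] if there is none), and [d] tells whether the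
   last letter is below [b]. *)
Fixpoint gf (k i a b : nat) (d : bool) : R :=
  if k is k'.+1 then
    \sum_(b <= c < i.+1)
       (if (b < c)%N then s else if d then t else u) * gf k' i.+1 a c false
    + u * ((b - a)%:R * q b) * gf k' i.+1 b b true
  else 1.

(* The next letter (if any) is a new maximum, at least [v]. *)
Definition rise (k i a v : nat) : R :=
  if k is k'.+1 then \sum_(v <= c < i.+1) s * gf k' i.+1 a c false else 1.

Lemma gf_rec k i a b d : (b <= i)%N ->
  gf k.+1 i a b d = rise k.+1 i a b.+1 + (if d then t else u) * gf k i.+1 a b false
    + u * ((b - a)%:R * q b) * gf k i.+1 b b true.
Proof.
move=> le_bi; rewrite /= big_ltn ?ltnS // ltnn [_ * _ + _]addrC; congr (_ + _ + _).
by apply: eq_big_nat => c /andP[-> _].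
Qed.

Lemma rise_rec k i a v : (v <= i)%N ->
  rise k.+1 i a v = rise k.+1 i a v.+1 + s * gf k i.+1 a v false.
Proof. by move=> le_vi; rewrite /= big_ltn ?ltnS // addrC. Qed.

Variable n : nat.

Definition gf_poly (a v : nat) (d : bool) : {poly R} :=
  \poly_(h < (n - v).+1) gf (n - v - h) (v + h) a v d.

Definition rise_poly (a v : nat) : {poly R} :=
  \poly_(h < (n - v).+1) rise (n - v - h) (v + h) a v.

(** Raising [v] by one lowers the offset [h] of a fixed position by one: this is one factor ['X],
    the other being the one on the left of the equations below. At [h = 0] no maximum above [v] fits
    at position [v], and the sum in [rise] is empty. *)
Lemma coef_X2_rise_poly a v h : (v < n)%N ->
  ('X^2 * rise_poly a v.+1)`_h.+1
  = if (h < (n - v).+1)%N then rise (n - v - h) (v + h) a v.+1 else 0.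
Proof.
move=> lt_vn; rewrite coefXnM coef_poly.
case: h => [|h]; first by rewrite /= addn0 subn0 -[(n - v)%N]prednK ?subn_gt0 //= big_geq.
have -> : (h.+1 < (n - v).+1)%N = (h < (n - v.+1).+1)%N by lia.
have -> : (n - v - h.+1 = n - v.+1 - h)%N by lia.
by rewrite [(h.+2 - 2)%N]subn2 addnS.
Qed.

Lemma rise_polyE a v : (v < n)%N ->
  'X * rise_poly a v = 'X^2 * rise_poly a v.+1
    + s%:P * (gf_poly a v false - ((gf_poly a v false)`_0)%:P).
Proof.
move=> lt_vn; apply/polyP => -[|h].
  by rewrite coefXM coefD coefXnM coefCM coefB coefC /= subrr mulr0 addr0.
rewrite coefXM coefD coef_X2_rise_poly // coefCM coefB coefC /= subr0 !coef_poly.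
case: (ltngtP h (n - v)) => [lt_h|gt_h|->].
- by rewrite !ltnS lt_h ltnW // addnS -subnSK // rise_rec ?leq_addr.
- by rewrite !ltnS (leqNgt h) gt_h (ltnNge h) (ltnW gt_h) /= !mulr0 !addr0.
- by rewrite ltnSn ltnn subnn mulr0 addr0.
Qed.

Lemma gf_polyE a v d : (v < n)%N ->
  'X * gf_poly a v d = 'X^2 * rise_poly a v.+1
    + (if d then t else u)%:P * (gf_poly a v false - ((gf_poly a v false)`_0)%:P)
    + (u * ((v - a)%:R * q v))%:P * (gf_poly v v true - ((gf_poly v v true)`_0)%:P).
Proof.
move=> lt_vn; apply/polyP => -[|h].
  by rewrite coefXM !coefD coefXnM !coefCM !coefB !coefC /= !subrr !mulr0 !addr0.
rewrite coefXM !coefD coef_X2_rise_poly // !coefCM !coefB !coefC /= !subr0 !coef_poly.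
case: (ltngtP h (n - v)) => [lt_h|gt_h|->].
- by rewrite !ltnS lt_h ltnW // addnS -subnSK // gf_rec ?leq_addr.
- by rewrite !ltnS (leqNgt h) gt_h (ltnNge h) (ltnW gt_h) /= !mulr0 !addr0.
- by rewrite ltnSn ltnn subnn !mulr0 !addr0.
Qed.

(** Here [v - a] is zero, so the descent term vanishes and eliminating [gf_poly] costs a single
    factor ['X - u]. *)
Lemma rise_poly_kernel0 a v : (v < n)%N -> (v <= a)%N ->
  ('X - u%:P) * rise_poly a v
  = 'X * ('X - u%:P + s%:P) * rise_poly a v.+1 - s%:P * ((gf_poly a v false)`_0)%:P.
Proof.
move=> lt_vn le_va; have EF := rise_polyE a lt_vn; have EY := gf_polyE a false lt_vn.
move: EY; rewrite (eqP le_va) mul0r mulr0 polyC0 mul0r addr0.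
set Y := gf_poly _ _ _; set y0 := (Y`_0)%:P in EF * => EY.
apply: polyX_inj; rewrite /= mulrCA EF mulrDr mulrCA [_ * (s%:P * _)]mulrCA.
have -> : ('X - u%:P) * (Y - y0) = 'X^2 * rise_poly a v.+1 - 'X * y0.
  by rewrite mulrBl mulrBr EY; ring.
by ring.
Qed.

Hypothesis su : s * u = t.

(** After a descent from [v] the threshold is [v] itself, so no further descent from [v] occurs and
    the equations for [gf_poly v v] close. Solving them costs one factor ['X - u], and solving for
    [gf_poly a v false] a second one. *)
Lemma rise_poly_kernel a v : (v < n)%N ->
  ('X - u%:P) ^+ 2 * rise_poly a v
  = 'X * ('X - u%:P) * ('X - u%:P + s%:P) * rise_poly a v.+1
    + (t * ((v - a)%:R * q v))%:P * ('X - u%:P + t%:P) * rise_poly v v.+1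
    - s%:P * ('X - u%:P) * ((gf_poly a v false)`_0)%:P
    - (t * ((v - a)%:R * q v))%:P * ((gf_poly v v true)`_0)%:P.
Proof.
move=> lt_vn; set w := (v - a)%:R * q v.
have EF := rise_polyE a lt_vn; have EY := gf_polyE a false lt_vn.
rewrite -/w in EY; clearbody w.
have EV := gf_polyE v true lt_vn; have EZ := gf_polyE v false lt_vn.
rewrite subnn mul0r mulr0 polyC0 !mul0r !addr0 in EV EZ.
(* By the coefficients of ['X] in [EV] and [EZ], the two constant terms are [t] and [u] times the
   same coefficient. *)
have uv : u * (gf_poly v v true)`_0 = t * (gf_poly v v false)`_0.
  have := congr1 (fun p : {poly R} => p`_1) EV; have := congr1 (fun p : {poly R} => p`_1) EZ.
  rewrite !(coefXM, coefD, coefXnM, coefCM, coefN, coefC) /= !oppr0 !addr0 !add0r => -> ->.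
  by rewrite mulrCA.
move/(congr1 (@polyC R)): uv; rewrite !polyCM.
move: EF EY EV EZ; rewrite -su !polyCM.
set F := rise_poly a v; set F1 := rise_poly a v.+1; set F2 := rise_poly v v.+1.
set Y := gf_poly a v false; set V := gf_poly v v true; set Z := gf_poly v v false.
set y := (Y`_0)%:P; set x := (V`_0)%:P; set z := (Z`_0)%:P.
move: (s%:P) (u%:P) (w%:P) F F1 F2 Y V Z y x z => S U W F F1 F2 Y V Z y x z.
move=> EF EY EV EZ uv.
have HZ : ('X - U) * (Z - z) = 'X^2 * F2 - 'X * z by rewrite mulrBl mulrBr EZ; ring.
have HV : ('X - U) * (V - x) = 'X * ('X - U + S * U) * F2 - 'X * x.
  apply: polyX_inj; rewrite /= mulrCA mulrBr EV.
  transitivity ('X^2 * ('X - U) * F2 + S * U * (('X - U) * (Z - z)) - 'X^2 * x + 'X * (U * x)); first by ring.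
  by rewrite HZ uv; ring.
have HY : ('X - U) * (Y - y) = 'X^2 * F1 - 'X * y + U * W * (V - x).
  by rewrite mulrBl mulrBr EY; ring.
apply: polyX_inj; rewrite /= mulrCA EF.
transitivity (('X - U) ^+ 2 * ('X^2 * F1) + S * ('X - U) * (('X - U) * (Y - y))); first by ring.
rewrite HY.
transitivity (('X - U) ^+ 2 * ('X^2 * F1) + S * ('X - U) * ('X^2 * F1 - 'X * y) + S * U * W * (('X - U) * (V - x))); first by ring.
by rewrite HV; ring.
Qed.

End Recursion.

(** Monicity makes degrees add although [R] need not be a domain. *)
Lemma monic_sqr_mul_eq0 (c : R) (D : {poly R}) :
  (size (('X - c%:P) ^+ 2 * D)%R <= 2)%N -> D = 0.
Proof.
move=> szD; apply/eqP; apply: contraTT szD => D0; rewrite -ltnNge.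
rewrite size_monicM ?monic_exp ?monicXsubC // size_exp_XsubC.
rewrite addSn -pred_Sn -[X in (X < _)%N]addn0 ltn_add2l.
by rewrite size_poly_gt0.
Qed.

Lemma rise_poly_shift n a v : (v <= n)%N ->
  rise_poly 1 t n a v \Po ('X + (t - 1)%:P) = rise_poly t 1 n a v.
Proof.
move=> le_vn; have [m ->] : exists m, v = (n - m)%N by exists (n - v)%N; lia.
elim: m a => [|m IHm] a.
  rewrite subn0 /rise_poly subnn !poly_def !big_ord1 /=.
  by rewrite expr0 !scale1r comp_polyC.
case: (ltnP m n) => [lt_mn|le_nm]; last first.
  by have -> : (n - m.+1 = n - m)%N by lia; apply: IHm.
have Ev : (n - m = (n - m.+1).+1)%N by lia.
have lt_vn : (n - m.+1 < n)%N by lia.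
rewrite Ev in IHm; move: (n - m.+1)%N lt_vn IHm => {le_vn Ev lt_mn m v} v lt_vn IH.
have EA := @rise_poly_kernel t 1 n (mulr1 t) a v lt_vn.
have EB := @rise_poly_kernel 1 t n (mul1r t) a v lt_vn.
(* The shift sends ['X - t] to ['X - 1], and the factors ['X] and ['X - t + 1] to ['X - 1 + t] and
   ['X]: the kernel for [(1, t)] becomes that for [(t, 1)]. *)
move/(congr1 (fun p => p \Po ('X + (t - 1)%:P))): EB.
rewrite expr2 !(comp_polyB, comp_polyD, comp_polyM, comp_polyC, comp_polyX) !IH.
move: ((gf_poly 1 t n a v false)`_0) ((gf_poly 1 t n v v true)`_0) => yB xB.
move: ((gf_poly t 1 n a v false)`_0) ((gf_poly t 1 n v v true)`_0) EA => yA xA EA.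
move: (_ * q v) EA => w EA EB; apply/eqP; rewrite -subr_eq0; apply/eqP.
apply: (@monic_sqr_mul_eq0 1); rewrite mulrBr EA.
set FB := _ \Po _ in EB *.
have -> : ('X - 1%:P) ^+ 2 * FB
        = ('X + (t - 1)%:P - t%:P) * ('X + (t - 1)%:P - t%:P) * FB by ring.
rewrite {}EB.
set D := (X in polyseq X).
have -> : D = (t * yA - yB)%:P * 'X + (yB - t * yA + t * w * (xA - xB))%:P.
  by rewrite /D; ring.
rewrite size_MXaddC; case: ifP => // _; rewrite ltnS.
exact: size_polyC_leq1.
Qed.

(** The factor in front of [rise_poly 0 1] in [rise_poly_kernel0] vanishes at [0] for [(1, t)] and
    at [1 - t] for [(t, 1)]. The shift matches these two points, and what remains of each equation
    is the constant term of [gf_poly]. *)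
Lemma gf_duality n : (0 < n)%N ->
  gf 1 t n 0 0 0 false = t * gf t 1 n 0 0 0 false.
Proof.
move=> n_gt0.
have EA := @rise_poly_kernel0 t 1 n 0 0 n_gt0 (leqnn 0).
have EB := @rise_poly_kernel0 1 t n 0 0 n_gt0 (leqnn 0).
have := congr1 (fun p => p.[1 - t]) (rise_poly_shift 0 (leq0n n)).
rewrite horner_comp hornerD hornerX hornerC; have -> : 1 - t + (t - 1) = 0 by ring.
move/(congr1 (fun p => p.[1 - t])): EA; move/(congr1 (fun p => p.[0])): EB.
rewrite !hornerE !coef_poly !ltn0Sn !subn0 !addn0 => EB EA E0.
apply: oppr_inj; rewrite -EB E0.
by transitivity ((1 - t - 1) * (rise_poly t 1 n 0 0).[1 - t]); [ring | rewrite EA; ring].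
Qed.

End Kernel.

(** * Sums over all words with a given prefix *)

Section PrefixSum.
Variables (V : nmodType) (n : nat) (f : seq nat -> V).

Definition prefix_sum (k : nat) (p : seq nat) : V :=
  \sum_(e : k.-tuple 'I_n) f (p ++ [seq val x | x <- e]).

Lemma prefix_sum0 p : prefix_sum 0 p = f p.
Proof.
rewrite /prefix_sum (big_pred1 [tuple]) /= ?cats0 // => e.
by apply/esym/eqP; apply: tuple0.
Qed.

Lemma prefix_sumS k p :
  prefix_sum k.+1 p = \sum_(0 <= c < n) prefix_sum k (rcons p c).
Proof.
rewrite big_mkord pair_big /prefix_sum /=.
rewrite (reindex (fun ce : 'I_n * k.-tuple 'I_n => [tuple of ce.1 :: ce.2])) /=.
  by apply: eq_bigr => -[c e] _; rewrite cat_rcons.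
exists (fun e : k.+1.-tuple 'I_n => (thead e, [tuple of behead e])) => [[c e]|e] _.
  by congr (_, _); apply: val_inj.
by rewrite [RHS]tuple_eta.
Qed.

End PrefixSum.

Section Weights.
Variables (R : comNzRingType) (t : R) (q : nat -> R).

Definition dt_weight (w : seq nat) : R := \prod_(x <- descent_tops w) q x.

Lemma dt_weight_rcons p c :
  dt_weight (rcons p c)
  = dt_weight p * (if (c < last 0 p)%N then q (last 0%N p) else 1).
Proof.
rewrite /dt_weight descent_tops_rcons big_cat /=.
by case: ltnP => _; rewrite ?big_seq1 ?big_nil.
Qed.

(** * The class avoiding (>,-,>) *)

Section FirstPattern.

Local Notation adm := (admissible gtn any_rel gtn).
Local Notation ext := (extends gtn any_rel gtn).

Definition asc_weight (w : seq nat) : R :=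
  if adm w then t ^+ asc w * dt_weight w else 0.

Lemma asc_weight_rcons p c : adm p -> adm (rcons p c) ->
  asc_weight (rcons p c)
  = asc_weight p * (if (last 0 p < c)%N then t else 1)
                 * (if (c < last 0 p)%N then q (last 0%N p) else 1).
Proof.
rewrite /asc_weight => -> adm_pc; rewrite adm_pc.
have [_ le_cp _] := (admissible_rcons gtn any_rel gtn p c).1 adm_pc.
rewrite dt_weight_rcons asc_rcons // exprD.
by case: (ltnP _ c) => _; rewrite ?expr1 ?expr0; ring.
Qed.

Lemma prefix_sum_asc_eq0 n k p : ~~ adm p -> prefix_sum n asc_weight k p = 0.
Proof.
move=> nadm; rewrite /prefix_sum big1 // => e _; rewrite /asc_weight.
by case: ifP => // /admissible_catl adm_p; rewrite adm_p in nadm.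
Qed.

(** Induction on [k]. The hypotheses say that [(a, b)] is the state reached by [p]; [0 :: p] gives
    the empty prefix maximum [0]. A last letter below [b] has just caused a descent from [b] or
    follows one, whence [a = b]. *)
Lemma prefix_sum_asc n k p a b :
    (size p + k)%N = n -> adm p -> (forall c, ext p c <-> (a <= c)%N) ->
    (forall y, y \in p -> (y <= b)%N) -> b \in 0%N :: p -> (a <= b)%N ->
    last 0%N p = b \/ ((last 0 p < b)%N /\ a = b) ->
  prefix_sum n asc_weight k p
  = asc_weight p * gf t q t 1 k (size p) a b (last 0 p < b)%N.
Proof.
elim: k p a b => [|k IHk] p a b sz_p adm_p extP max_b b_p le_ab lastP.
  by rewrite prefix_sum0 mulr1.
have le_bp : (b <= size p)%N.
  move: b_p; rewrite inE => /predU1P[->//|].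
  by move/inversion_seq_bound/ltnW; apply; case/andP: adm_p.
have le_last : (last 0 p <= b)%N by case: lastP => [->|[/ltnW]].
have admP c : (c <= size p)%N -> (a <= c)%N -> adm (rcons p c).
  by move=> le_cp le_ac; apply/admissible_rcons; split=> //; apply/extP.
rewrite prefix_sumS (@big_cat_nat _ _ _ (size p).+1) //=; last by lia.
rewrite [X in _ + X]big_nat_cond [X in _ + X]big1 ?addr0; last first.
  move=> c; rewrite andbT => /andP[lt_pc _]; apply: prefix_sum_asc_eq0.
  by apply/negP => /admissible_rcons[_]; rewrite leqNgt lt_pc.
rewrite (@big_cat_nat _ _ _ b) //=; last exact: leqW.
rewrite (@big_cat_nat _ _ _ a) //=.
rewrite [X in X + _ + _]big_nat_cond [X in X + _ + _]big1 ?add0r; last first.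
  move=> c; rewrite andbT => /andP[_ lt_ca]; apply: prefix_sum_asc_eq0.
  by apply/negP => /admissible_rcons[_ _ /extP]; rewrite leqNgt lt_ca.
rewrite addrC mulrDr; congr (_ + _).
  rewrite mulr_sumr; apply: eq_big_nat => c /andP[le_bc]; rewrite ltnS => le_cp.
  have le_ac := leq_trans le_ab le_bc; have adm_pc := admP c le_cp le_ac.
  rewrite (IHk _ a c) ?size_rcons ?last_rcons ?ltnn //; first last.
  - by left.
  - by rewrite inE mem_rcons inE eqxx orbT.
  - by move=> y; rewrite mem_rcons inE => /predU1P[->//|/max_b/leq_trans]; apply.
  - move=> d; split=> [/extends_rcons[/extP]//|le_ad].
    apply/extends_rcons; split; first exact/extP.
    by move=> y /max_b le_yb /=; rewrite ltnNge (leq_trans le_yb le_bc).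
  - by rewrite addSnnS.
  rewrite asc_weight_rcons // [(c < last _ _)%N]ltnNge (leq_trans le_last) //= mulr1.
  rewrite mulrA; congr (_ * _ * _).
  (* Returning to [b] is an ascent exactly when the last letter is below [b], as the flag
     records. *)
  case: (ltngtP b c) le_bc => // [lt_bc|<-] _; last by [].
  by rewrite (leq_ltn_trans le_last lt_bc).
rewrite -[X in _ = asc_weight p * (1 * (X * _) * _)]/((b - a)%:R) mul1r.
rewrite -mulrA mulr_natl mulrnAr -sumr_const_nat; apply: eq_big_nat => c /andP[le_ac lt_cb].
(* Otherwise [a = b], and no [c] lies in this range. *)
have last_b : last 0%N p = b by case: lastP => // -[_ ab]; move: lt_cb; rewrite -ab ltnNge le_ac.
have le_cp := leq_trans (ltnW lt_cb) le_bp; have adm_pc := admP c le_cp le_ac.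
have b_p' : b \in p by move: b_p lt_cb; rewrite inE => /predU1P[->|].
rewrite (IHk _ b b) ?size_rcons ?last_rcons ?lt_cb //; first last.
- by right.
- by rewrite inE mem_rcons inE b_p' !orbT.
- by move=> y; rewrite mem_rcons inE => /predU1P[->|/max_b//]; apply: ltnW.
- move=> d; split=> [/extends_rcons[_ /(_ b b_p')]|le_bd].
    by rewrite /= lt_cb /= -leqNgt.
  apply/extends_rcons; split; first by apply/extP; apply: leq_trans le_bd.
  by move=> y /max_b le_yb /=; rewrite [(d < y)%N]ltnNge (leq_trans le_yb) ?andbF.
- by rewrite addSnnS.
by rewrite asc_weight_rcons // last_b lt_cb ltnNge (ltnW lt_cb) /= mulr1 mulrA.
Qed.

End FirstPattern.

(** * The class avoiding (>,!=,>=) *)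

Section SecondPattern.

Local Notation adm := (admissible gtn neq_rel geq).
Local Notation ext := (extends gtn neq_rel geq).

(* The exponent of [t] exceeds [size w - 1 - asc w] by one, so that the empty
   prefix has weight [1]. *)
Definition nonasc_weight (w : seq nat) : R :=
  if adm w then t ^+ (size w - asc w) * dt_weight w else 0.

Lemma nonasc_weight_rcons p c : adm p -> adm (rcons p c) ->
  nonasc_weight (rcons p c)
  = nonasc_weight p * (if (last 0 p < c)%N then 1 else t)
                    * (if (c < last 0 p)%N then q (last 0%N p) else 1).
Proof.
rewrite /nonasc_weight => -> adm_pc; rewrite adm_pc.
have [_ le_cp _] := (admissible_rcons gtn neq_rel geq p c).1 adm_pc.
rewrite dt_weight_rcons asc_rcons // size_rcons.
have le_asc : (asc p <= size p)%N by apply: leq_trans (asc_leq_size p) (leq_pred _).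
by case: (ltnP _ c) => _; rewrite ?addn1 ?addn0 ?subSS ?subSn // ?exprS; ring.
Qed.

Lemma prefix_sum_nonasc_eq0 n k p :
  ~~ adm p -> prefix_sum n nonasc_weight k p = 0.
Proof.
move=> nadm; rewrite /prefix_sum big1 // => e _; rewrite /nonasc_weight.
by case: ifP => // /admissible_catl adm_p; rewrite adm_p in nadm.
Qed.

(* The flag [d] is arbitrary because [gf t q 1 t] does not depend on it: with
   [u = t] its two branches agree. *)
Lemma prefix_sum_nonasc n k p x m b d :
    (size p + k)%N = n -> adm p ->
    (forall c, ext p c <-> (c == x) || (m < c)%N) ->
    (forall y, y \in p -> (y <= b)%N) -> b \in 0%N :: p ->
    (x <= m <= b)%N -> last 0%N p = (if b == m then x else b) ->
  prefix_sum n nonasc_weight k p = nonasc_weight p * gf t q 1 t k (size p) m b d.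
Proof.
elim: k p x m b d => [|k IHk] p x m b d sz_p adm_p extP max_b b_p.
  by rewrite prefix_sum0 mulr1.
case/andP=> le_xm le_mb lastE.
have le_bp : (b <= size p)%N.
  move: b_p; rewrite inE => /predU1P[->//|].
  by move/inversion_seq_bound/ltnW; apply; case/andP: adm_p.
have admP c : (c <= size p)%N -> (c == x) || (m < c)%N -> adm (rcons p c).
  by move=> le_cp ok_c; apply/admissible_rcons; split=> //; apply/extP.
(* A plateau or a new maximum keeps the last descent, hence [x] and [m]. *)
have riseE c : (b <= c <= size p)%N -> (m < c)%N ->
    prefix_sum n nonasc_weight k (rcons p c)
    = nonasc_weight p * ((if (b < c)%N then 1 else if d then t else t)
                         * gf t q 1 t k (size p).+1 m c false).
  move=> /andP[le_bc le_cp] lt_mc.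
  have adm_pc : adm (rcons p c) by rewrite admP ?lt_mc ?orbT.
  have le_last : (last 0 p <= b)%N by rewrite lastE; case: eqP => // ->; lia.
  rewrite (IHk _ x m c false) ?size_rcons ?last_rcons //; first last.
  - by rewrite gtn_eqF.
  - by rewrite le_xm ltnW.
  - by rewrite inE mem_rcons inE eqxx orbT.
  - by move=> y; rewrite mem_rcons inE => /predU1P[->//|/max_b/leq_trans]; apply.
  - move=> e; split=> [/extends_rcons[/extP]//|ok_e].
    apply/extends_rcons; split; first exact/extP.
    by move=> y /max_b le_yb /=; rewrite ltnNge (leq_trans le_yb le_bc).
  - by rewrite addSnnS.
  rewrite nonasc_weight_rcons // [(c < last _ _)%N]ltnNge (leq_trans le_last) //= mulr1.
  rewrite mulrA; congr (_ * _ * _); rewrite if_same.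
  case: (ltngtP b c) le_bc => // [lt_bc|bc] _.
    by rewrite (leq_ltn_trans le_last lt_bc).
  by rewrite lastE -bc; case: eqP => [mb|_]; [move: lt_mc; rewrite -bc mb ltnn | rewrite ltnn].
(* For [b = m] the last letter is [x] and [c] repeats it, without a descent; otherwise [c] creates
   the descent top [b]. *)
have dropE c e : (c <= b)%N -> (c == x) || (m < c < b)%N ->
    prefix_sum n nonasc_weight k (rcons p c)
    = nonasc_weight p * ((if b == m then t else t * q b)
                         * gf t q 1 t k (size p).+1 b b e).
  move=> le_cb ok_c; have le_cp := leq_trans le_cb le_bp.
  have adm_pc : adm (rcons p c).
    by apply: admP => //; case/orP: ok_c => [->|/andP[-> _]]; rewrite ?orbT.
  rewrite (IHk _ c b b e) ?size_rcons ?last_rcons ?eqxx //; first last.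
  - by rewrite le_cb leqnn.
  - by move: b_p; rewrite !inE mem_rcons inE => /orP[->|->]; rewrite ?orbT.
  - by move=> y; rewrite mem_rcons inE => /predU1P[->//|/max_b].
  - move=> y; split.
      case/extends_rcons => /extP ok_y no_y; case: eqP => //= /eqP ne_yc.
      case: (eqVneq b m) => [eq_bm|ne_bm].
        have cx : c = x by case/orP: ok_c => [/eqP//|]; lia.
        by move: ok_y; rewrite -cx (negPf ne_yc) eq_bm.
      have lt_cb : (c < b)%N by case/orP: ok_c => [/eqP->|/andP[]//]; lia.
      have b_p' : b \in p by move: b_p lt_cb; rewrite inE => /predU1P[->|].
      by have := no_y b b_p'; rewrite /neq_rel /= lt_cb eq_sym ne_yc -ltnNge.
    move=> ok_y; apply/extends_rcons; split.
      apply/extP; case/orP: ok_y => [/eqP->|]; last by lia.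
      by case/orP: ok_c => [->|/andP[-> _]]; rewrite ?orbT.
    move=> z /max_b le_zb; case/orP: ok_y => [/eqP->|lt_by] /=; first by rewrite /neq_rel /= eqxx andbF.
    by rewrite [(y <= z)%N]leqNgt (leq_ltn_trans le_zb lt_by) !andbF.
  - by rewrite addSnnS.
  rewrite nonasc_weight_rcons // lastE mulrA; congr (_ * _); rewrite -mulrA; congr (_ * _).
  case: (altP (b =P m)) ok_c => [->|ne_bm] ok_c.
    have -> : c = x by case/orP: ok_c => [/eqP//|]; lia.
    by rewrite ltnn mulr1.
  have lt_cb : (c < b)%N by case/orP: ok_c => [/eqP->|/andP[]//]; lia.
  by rewrite lt_cb ltnNge ltnW.
rewrite prefix_sumS (@big_cat_nat _ _ _ (size p).+1) //=; last by lia.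
rewrite [X in _ + X]big_nat_cond [X in _ + X]big1 ?addr0; last first.
  move=> c; rewrite andbT => /andP[lt_pc _]; apply: prefix_sum_nonasc_eq0.
  by apply/negP => /admissible_rcons[_]; rewrite leqNgt lt_pc.
rewrite (@big_cat_nat _ _ _ m.+1) //=; last by rewrite ltnS (leq_trans le_mb).
have lowE e : \sum_(0 <= c < m.+1) prefix_sum n nonasc_weight k (rcons p c)
  = nonasc_weight p * ((if b == m then t else t * q b)
                         * gf t q 1 t k (size p).+1 b b e).
  rewrite -(@dropE x e) ?eqxx ?(leq_trans le_xm) //.
  rewrite (bigD1_seq x) ?mem_index_iota ?iota_uniq //= big_nat_cond big1 ?addr0 //.
  move=> c /andP[/andP[_ le_cm] ne_cx]; apply: prefix_sum_nonasc_eq0.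
  by apply/negP => /admissible_rcons[_ _ /extP]; rewrite (negPf ne_cx) ltnNge -ltnS le_cm.
(* If [b = m], repeating [x] provides the summand [c = b] of [gf], and the descent term is zero. *)
case: (eqVneq b m) lowE => [eq_bm lowE|ne_bm lowE].
  rewrite (lowE false) eq_bm subnn mul0r mulr0 mul0r addr0.
  rewrite [X in _ = _ * X]big_ltn ?ltnS -?eq_bm // ltnn if_same mulrDr; congr (_ + _).
  rewrite mulr_sumr; apply: eq_big_nat => c /andP[lt_bc]; rewrite ltnS => le_cp.
  by rewrite riseE ?le_cp ?(ltnW lt_bc) -?eq_bm // lt_bc.
have lt_mb : (m < b)%N by rewrite ltn_neqAle eq_sym ne_bm.
rewrite (@big_cat_nat _ _ _ b m.+1) //=; last exact: leqW.
rewrite addrA [LHS]addrC mulrDr; congr (_ + _).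
  rewrite mulr_sumr; apply: eq_big_nat => c /andP[le_bc]; rewrite ltnS => le_cp.
  by rewrite riseE ?le_bc ?le_cp // (leq_trans lt_mb).
rewrite (lowE true).
under eq_big_nat => c /andP[lt_mc lt_cb].
  rewrite (@dropE c true) ?(ltnW lt_cb) ?lt_mc ?lt_cb ?orbT // (negPf ne_bm).
  over.
(* The letter [x] and the [b - m - 1] letters strictly between [m] and [b] add up to the factor
   [b - m]. *)
rewrite sumr_const_nat -mulrS -subSn // subSS.
by rewrite -mulr_natl; ring.
Qed.

End SecondPattern.

End Weights.

(** * The identity in Z[q_0, q_1, ...][t] *)

Lemma qpow_Dt (w : seq nat) : qpow (Dt w) = dt_weight qvar w.
Proof. by rewrite /qpow /dt_weight; apply: perm_big; apply: perm_eq_seq_mset. Qed.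

Lemma dt_weight_polyC (R : comNzRingType) (q : nat -> R) (w : seq nat) :
  (dt_weight q w)%:P = dt_weight (fun x => (q x)%:P) w.
Proof. exact: rmorph_prod. Qed.

Unset Implicit Arguments.

(* An identity in Z[q_0, q_1, ...][t], with t rendered as 'X. *)
Theorem theorem1p3 (n : nat) (n_ge1 : (1 <= n)%N) :
  \sum_(e in inv_seqs n gtn any_rel gtn)
     qpow (Dt (word e)) *: 'X^(asc (word e))
  = \sum_(e in inv_seqs n gtn neq_rel geq)
     qpow (Dt (word e)) *: 'X^(n - 1 - asc (word e)) :> {poly qring}.
Proof.
pose Q x : {poly qring} := (qvar x)%:P.
have EA : \sum_(e in inv_seqs n gtn any_rel gtn)
    qpow (Dt (word e)) *: 'X^(asc (word e)) = prefix_sum n (asc_weight 'X Q) n [::].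
  rewrite big_mkcond; apply: eq_bigr => e _; rewrite inE /asc_weight /admissible.
  by case: ifP => // _; rewrite qpow_Dt -mul_polyC mulrC dt_weight_polyC.
(* The factor ['X] makes up for the extra [t] in [nonasc_weight]; it is the factor [t] of
   [gf_duality], and cancels at the end. *)
have EB : 'X * (\sum_(e in inv_seqs n gtn neq_rel geq)
      qpow (Dt (word e)) *: 'X^(n - 1 - asc (word e)))
    = prefix_sum n (nonasc_weight 'X Q) n [::].
  rewrite big_mkcond mulr_sumr; apply: eq_bigr => e _.
  rewrite inE /nonasc_weight /admissible; case: ifP => _; last by rewrite mulr0.
  rewrite qpow_Dt -mul_polyC mulrC -mulrA dt_weight_polyC [RHS]mulrC; congr (_ * _).
  have sz_e : size (word e) = n by rewrite size_map size_tuple.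
  have := asc_leq_size (word e); rewrite -exprSr sz_e => le_asc.
  by congr ('X^_); rewrite cat0s -/(word e); lia.
apply: (@polyX_inj qring); rewrite /= EA EB.
rewrite (@prefix_sum_asc _ _ _ _ _ _ 0 0) ?admissible_nil //; first last.
- by left.
- by move=> c; split=> // _; apply: extends_nil.
rewrite (@prefix_sum_nonasc _ _ _ _ _ _ 0 0 0 false) ?admissible_nil //; last first.
  by move=> c; split=> [_|_]; [case: c | apply: extends_nil].
rewrite /= gf_duality // /asc_weight /nonasc_weight !admissible_nil /= !ascE !big_ord0 expr0.
by rewrite mulrCA.
Qed.
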